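(* Let $X$ be a $T_1$ topological space. Then $X$ is the open continuous compact image of a metric space if and only if $X$ is metacompact and Nonempty has a convergent strategy in the Choquet game $\mathsf{Ch}(X)$. Moreover, if these conditions hold, then Nonempty has a stationary convergent strategy in $\mathsf{Ch}(X)$. (The strategies here are not required to be winning.)
   Context: A space $X$ is an open continuous compact image of a space $Y$ if there is an open continuous surjection $f\colon Y \to X$ such that $f^{-1}(\{x\})$ is compact for each $x\in X$. A space is metacompact if every open cover has a point-finite open refinement covering the space. The Choquet game $\mathsf{Ch}(X)$ on a topological space $X$ is played by two players, Empty and Nonempty, for $\omega$ rounds. On round $i$, Empty moves first, choosing a point $x_i \in X$ and an open set $U_i$ with $x_i \in U_i$ and, if $i \geq 1$, $U_i \subseteq V_{i-1}$. Then Nonempty responds with an open set $V_i$ such that $x_i \in V_i \subseteq U_i$. Empty wins the play if $\bigcap_{n<\omega} V_n = \varnothing$; otherwise Nonempty wins. A strategy for Nonempty is a function $\mathfrak{S}$ which takes a partial play ending with a move by Empty (recorded as the sequence $\langle x_j,U_j\rangle_{j\le i}$ of Empty's moves) and returns a legal open set $V_i$ for Nonempty to play. It is stationary if $\mathfrak{S}(\langle x_j,U_j\rangle_{j\le i}) = \mathfrak{S}(\langle x_i,U_i\rangle)$ for every partial play $\langle x_j,U_j\rangle_{j\le i}$ of Empty against $\mathfrak{S}$. It is convergent if for any play $\langle x_i,U_i,V_i\rangle_{i<\omega}$ following $\mathfrak{S}$, the collection $\{V_i : i<\omega\}$ is a neighborhood basis for any point in $\bigcap_i V_i$. Neither notion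 requires the strategy to be winning. *)

(* Defs.v *)
From HB Require Import structures.
From mathcomp Require Import all_boot all_order all_algebra.
From mathcomp Require Import all_classical all_reals all_analysis.

Set Implicit Arguments.
Unset Strict Implicit.
Unset Printing Implicit Defensive.

Local Open Scope classical_set_scope.

Definition open_compact_image (X Y : topologicalType) :=
  exists f : Y -> X,
    [/\ continuous f,
        forall U : set Y, open U -> open (f @` U),
        set_surj [set: Y] [set: X] f
      & forall x : X, compact (f @^-1` [set x])].

Definition open_cover (X : topologicalType) (C : set (set X)) :=
  C `<=` open /\ cover C id = [set: X].

Definition refines (X : Type) (D C : set (set X)) :=
  forall V, D V -> exists2 U, C U & V `<=` U.

Definition point_finite (X : Type) (D : set (set X)) :=
  forall x : X, finite_set [set V | D V /\ V x].

Definition metacompact (X : topologicalType) :=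
  forall C : set (set X), open_cover C ->
  exists D : set (set X), [/\ open_cover D, refines D C & point_finite D].

Definition nbhs_basis (X : topologicalType) (z : X) (B : set (set X)) :=
  (forall A, B A -> nbhs z A) /\
  (forall W, nbhs z W -> exists2 A, B A & A `<=` W).

(* Nonempty's responses as a function of the sequence of Empty's moves so far
   (oldest first). Only its values on partial plays against it matter. *)
Definition response (X : Type) := seq (X * set X) -> set X.

(* The sequences of moves that Empty can legally have made against S, so that
   Empty is to be answered. Nonempty's moves are recovered as the values of S
   on the nonempty prefixes. *)
Inductive partial_play (X : topologicalType) (S : response X) :
    seq (X * set X) -> Prop :=
| partial_play1 (x : X) (U : set X) of open U & U x :
    partial_play S [:: (x, U)]
| partial_playS (p : seq (X * set X)) (x : X) (U : set X)
    of partial_play S p & open U & U x & U `<=` S p :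
    partial_play S (rcons p (x, U)).

Definition strategy (X : topologicalType) (S : response X) :=
  forall (p : seq (X * set X)) (x : X) (U : set X),
  partial_play S (rcons p (x, U)) ->
  [/\ open (S (rcons p (x, U))), S (rcons p (x, U)) x
    & S (rcons p (x, U)) `<=` U].

Definition stationary (X : topologicalType) (S : response X) :=
  forall (p : seq (X * set X)) (x : X) (U : set X),
  partial_play S (rcons p (x, U)) -> S (rcons p (x, U)) = S [:: (x, U)].

Definition choquet_play (X : topologicalType)
    (x : nat -> X) (U V : nat -> set X) :=
  [/\ forall i, open (U i) /\ U i (x i),
      forall i, U i.+1 `<=` V i
    & forall i, [/\ open (V i), V i (x i) & V i `<=` U i]].

Definition follows (X : topologicalType) (S : response X)
    (x : nat -> X) (U V : nat -> set X) :=
  forall i, V i = S (mkseq (fun j => (x j, U j)) i.+1).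

Definition convergent (X : topologicalType) (S : response X) :=
  forall (x : nat -> X) (U V : nat -> set X),
  choquet_play x U V -> follows S x U V ->
  forall z : X, (\bigcap_i V i) z -> nbhs_basis z (range V).

(* Main.v *)
(* A development is a sequence of open covers G_0, G_1, ..., each refining the
   previous one, such that the stars of every point x in the G_n form a
   neighborhood basis of x.

   If f : Y -> X is open, continuous and has compact fibers, Y metric, then a
   Lebesgue number argument in the fibers shows that the images of the balls of
   radius 2^-n form a development.  A locally finite refinement of the preimage
   of a cover of X (Stone's theorem) has a point-finite image.  A development
   gives a stationary strategy: answer (x, U) inside a member of the first G_n
   such that U lies in no member of G_n.

   Conversely, metacompactness turns a convergent strategy S into point-finite
   open covers D_n, each member H of which carries a play against S whose last
   answer contains H, the play of a member of D_(n+1) extending that of a member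
   of D_n by a move (x, H).  By Koenig's lemma a point z and a neighborhood W
   such that no D_n has its star at z inside W would yield an infinite play
   contradicting convergence.  Finally X is the image of the space of sequences
   (H_n) with H_n in D_n and nonempty intersection, metrized by first
   difference: by T1 the intersection is one point, and the fiber of x is the
   product of the finite sets of members of D_n containing x. *)
Require Import Defs.
From HB Require Import structures.
From mathcomp Require Import all_boot all_order all_algebra.
From mathcomp Require Import finmap.
From mathcomp Require Import all_classical all_reals all_analysis.
From mathcomp Require Import wochoice lra.

Set Implicit Arguments.
Unset Strict Implicit.
Unset Printing Implicit Defensive.
Import Order.TTheory GRing.Theory Num.Theory.
Import numFieldNormedType.Exports.
Local Open Scope classical_set_scope.
Local Open Scope ring_scope.

(** * Metacompactness of open compact images *)

(** [m x] is the least [i] with [C i x] in a well-order of [I]; the two hypotheses make each of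
    [m x] and [m y] at most the other. *)
Lemma least_index (T : Type) (I : eqType) (C : I -> T -> Prop) :
  (forall x, exists i, C i x) ->
  exists m : T -> I, (forall x, C (m x) x) /\
    forall x y, C (m x) y -> C (m y) x -> m x = m y.
Proof.
move=> Ccov; have [R Rwo] := well_ordering_principle I.
have Rmin x : exists i, minimum_of R [pred i | `[< C i x >]] i.
  have [i Cix] := Ccov x.
  have [|j [jmin _]] := Rwo [pred i | `[< C i x >]]; last by exists j.
  by exists i; rewrite inE.
have [m mP] := choice Rmin; exists m.
have Cm x : C (m x) x by have [] := mP x; rewrite inE.
split=> // x y Cxy Cyx.
have Rxy : R (m x) (m y) by have [_] := mP x; apply; rewrite inE.
have Ryx : R (m y) (m x) by have [_] := mP y; apply; rewrite inE.
have [|j [_ jmin]] := Rwo (pred2 (m x) (m y)).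
  by exists (m x); rewrite !inE eqxx.
have refl z : R z z.
  have [|k [[]]] := Rwo (pred1 z); first by exists z; rewrite inE.
  by rewrite inE => /eqP -> /(_ z); rewrite inE => /(_ (eqxx _)).
rewrite -(jmin (m x)) ?(jmin (m y)) //; split; rewrite ?inE ?eqxx ?orbT // => z;
  by rewrite !inE => /orP[] /eqP ->.
Qed.

Section DyadicRadius.
Context {R : realType}.

Definition dyadic (n : nat) : R := 2^-1 ^+ n.

Lemma dyadic_gt0 n : 0 < dyadic n.
Proof. by rewrite exprn_gt0. Qed.

Lemma dyadicS n : dyadic n = 2 * dyadic n.+1.
Proof. by rewrite /dyadic exprS mulrA divff ?mul1r. Qed.

Lemma dyadic_le m n : (m <= n)%N -> dyadic n <= dyadic m.
Proof. by move=> mn; rewrite ler_wiXn2l//; lra. Qed.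

Lemma dyadic_lt (e : R) : 0 < e -> exists n, dyadic n < e.
Proof.
move=> e0; have : dyadic n @[n --> \oo] --> (0 : R).
  by apply: cvg_expr; rewrite ger0_norm; lra.
move/cvgrPdist_lt => /(_ e e0) [n _ /(_ n (leqnn n))] /=.
by rewrite sub0r normrN gtr0_norm ?dyadic_gt0 //; exists n.
Qed.

End DyadicRadius.

(* M. E. Rudin's proof of Stone's theorem, where [m x] plays the role of the
   least index of a member of the cover [C] containing [x]. *)
Section Rudin.
Context {R : realType} {Y : pseudoMetricType R} {I : choiceType}.
Variables (C : I -> set Y) (m : Y -> I).

(** The interior is taken since balls of a pseudometric type need not be open. Under [mC], the
    factor 3 keeps centres of one stage with different indices apart. *)
Definition rudin_step (n : nat) (B : set Y) (i : I) : set Y :=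
  \bigcup_(x in [set x | [/\ m x = i, ~ B x &
      ball x (3 * dyadic n : R) `<=` C i]])
    (ball x (dyadic n : R))°.

Fixpoint rudin_before (n : nat) : set Y :=
  if n is k.+1 then
    rudin_before k `|` \bigcup_i rudin_step k (rudin_before k) i
  else set0.

Definition rudin (n : nat) (i : I) := rudin_step n (rudin_before n) i.

Lemma rudin_open n i : open (rudin n i).
Proof. by apply: bigcup_open => x _; exact: open_interior. Qed.

Lemma rudin_sub n i : rudin n i `<=` C i.
Proof.
move=> y [x [_ _ sub] /interior_subset xy]; apply: sub.
by apply: le_ball xy; have := @dyadic_gt0 R n; lra.
Qed.

Lemma rudin_index n i y : rudin n i y -> exists x, m x = i.
Proof. by case=> x [mx _ _] _; exists x. Qed.

Lemma rudin_beforeP n y :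
  rudin_before n y <-> exists k i, (k < n)%N /\ rudin k i y.
Proof.
elim: n => [|n IH] /=; first by split=> // -[k [i []]].
split=> [[/IH [k [i [kn kiy]]]|[i _ ?]]|[k [i []]]].
- by exists k, i; split=> //; exact: ltnW.
- by exists n, i.
- rewrite ltnS leq_eqVlt => /orP[/eqP ->|kn kiy]; first by right; exists i.
  by left; apply/IH; exists k, i.
Qed.

Hypotheses (Cm : forall x, nbhs x (C (m x)))
  (mC : forall x y, C (m x) y -> C (m y) x -> m x = m y).

(** As soon as the ball of radius [3 * dyadic n] about [y] lies in [C (m y)], either [y] is covered
    before stage [n] or it is a centre of stage [n]. *)
Lemma rudin_cover y : exists n i, rudin n i y.
Proof.
have /nbhs_ballP [e /= e0 eC] := Cm y.
have [n ne] := @dyadic_lt R (e / 3) ltac:(by lra).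
have [yB|yB] := pselect (rudin_before n y).
  by have /rudin_beforeP [k [i [_ ?]]] := yB; exists k, i.
exists n, (m y); exists y.
  by split=> //; apply: subset_trans eC; apply: le_ball; lra.
by apply: nbhsx_ballx; exact: dyadic_gt0.
Qed.

Lemma rudin_locally_finite (y : Y) : exists2 N : set Y, nbhs y N &
  finite_set [set p : nat * I | rudin p.1 p.2 `&` N !=set0].
Proof.
have [n [i niy]] := rudin_cover y.
have /nbhs_ballP [e /= e0 eD] : nbhs y (rudin n i).
  by apply: open_nbhs_nbhs; split=> //; exact: rudin_open.
have [j je] := dyadic_lt e0.
(* For [k >= M], a piece of stage [k] meeting this ball would have its centre within [dyadic j] of
   [y], hence in the earlier piece [rudin n i]. *)
set M := (n + j).+1; exists (ball y (dyadic M : R)).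
  by apply: nbhsx_ballx; exact: dyadic_gt0.
pose hit k := [set i' | rudin k i' `&` ball y (dyadic M : R) !=set0].
apply: (@sub_finite_set _ _ (\bigcup_(k in `I_M) (pair k @` hit k))).
  move=> [k i'] /= hki; exists k; last by exists i'.
  have [p [[z [_ zB _] /interior_subset zp] yp]] := hki.
  rewrite /= ltnNge; apply/negP => Mk; apply: zB; apply/rudin_beforeP.
  exists n, i; split; first by apply: leq_trans Mk; rewrite ltnS leq_addr.
  apply: eD; apply: le_ball (ball_triangle yp (ball_sym zp)).
  have := @dyadic_le R _ _ Mk; have := @dyadicS R (n + j).
  have := @dyadic_le R _ _ (leq_addl n j); rewrite -/M; lra.
apply: bigcup_finite => [|k kM]; first exact: finite_II.
apply: finite_image.
(* For [k < M] only one index is hit: two centres would be within [2 * dyadic k + 2 * dyadic M <= 3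
   * dyadic k]. *)
have hit1 i1 i2 : hit k i1 -> hit k i2 -> i1 = i2.
  move=> [p [[z [<- _ zC] /interior_subset zp] yp]].
  move=> [q [[w [<- _ wC] /interior_subset wq] yq]].
  have zw : ball z (3 * dyadic k : R) w.
    apply: le_ball (ball_triangle zp (ball_triangle (ball_sym yp)
      (ball_triangle yq (ball_sym wq)))).
    have : dyadic M <= dyadic k.+1 :> R by exact: dyadic_le.
    by have := @dyadicS R k; lra.
  by apply: mC; [exact: zC|exact/wC/ball_sym].
have [[i0 hi0]|h0] := pselect (exists i0, hit k i0).
  by apply: (sub_finite_set _ (finite_set1 i0)) => i1 /hit1; exact.
by apply: (sub_finite_set _ (finite_set0 _)) => i1 hi1; apply: h0; exists i1.
Qed.

End Rudin.

Lemma compact_locally_finite (T : topologicalType) (J : Type)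
    (E : J -> set T) (K : set T) : compact K ->
  (forall y, K y -> exists2 N : set T, nbhs y N &
    finite_set [set j | E j `&` N !=set0]) ->
  finite_set [set j | E j `&` K !=set0].
Proof.
move=> /compact_near_coveringP Kcov locfin.
(* [F] is generated by the up-sets of finite sets; near covering along it yields one finite set
   serving all points of [K]. *)
pose F := filter_from finite_set (fun G : set J => [set H | G `<=` H]).
have FF : Filter F.
  apply: filter_from_filter; first by exists set0; exact: finite_set0.
  move=> G H finG finH; exists (G `|` H); first by rewrite finite_setU.
  by move=> L /= GHL; split=> j ?; apply: GHL; [left|right].
have [y Ky|G finG /(_ G (@subset_refl _ G)) KG] :=
    Kcov _ F (fun G y => forall j, E j y -> G j) FF.
  have [N yN finN] := locfin y Ky.
  exists (N, [set H | [set j | E j `&` N !=set0] `<=` H]).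
    by split=> //; exists [set j | E j `&` N !=set0].
  by move=> [z H] [/= Nz sub] j Ejz; apply: sub; exists z.
by apply: sub_finite_set finG => j [y [Ejy /KG]]; exact.
Qed.

Lemma open_compact_image_metacompact (R : realType) (X : topologicalType)
  (Y : pseudoMetricType R) : open_compact_image X Y -> metacompact X.
Proof.
move=> [f [fcont fopen fsurj fcpt]] C [Copen Ccov].
have [y|m [Cm mC]] := @least_index Y (set X) (fun U y => C U /\ U (f y)).
  have : cover C id (f y) by rewrite Ccov.
  by case=> U CU Ufy; exists U.
pose P U := f @^-1` U.
have mP y : nbhs y (P (m y)).
  have [CU Uy] := Cm y; apply: open_nbhs_nbhs; split=> //.
  by apply: open_comp (Copen _ CU) => z _; exact: fcont.
have mPP x y : P (m x) y -> P (m y) x -> m x = m y.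
  have [Cx _] := Cm x; have [Cy _] := Cm y.
  by move=> xy yx; apply: mC.
pose E n U := f @` rudin (R := R) P m n U.
exists [set V | exists n U, C U /\ V = E n U]; split.
- split=> [V [n [U [CU ->]]]|]; first exact/fopen/rudin_open.
  apply/seteqP; split=> // x _; have [y _ <-] := fsurj x I.
  have [n [U nUy]] := rudin_cover (R := R) mP y.
  exists (E n U); last by exists y.
  (* The pieces are indexed by all sets, but the index of a nonempty piece is some [m z], which
     belongs to [C]. *)
  exists n, U; split=> //; have [z <-] := rudin_index nUy.
  by have [] := Cm z.
- move=> V [n [U [CU ->]]]; exists U => //.
  by move=> _ [y /rudin_sub + <-].
- move=> x; apply: (@sub_finite_set _ _ ((fun p => E p.1 p.2) @`
    [set p : nat * set X |
      rudin (R := R) P m p.1 p.2 `&` f @^-1` [set x] !=set0])).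
    by move=> V /= [[n [U [CU ->]]] [y nUy fyx]]; exists (n, U) => //; exists y.
  apply/finite_image/compact_locally_finite; first exact: fcpt.
  by move=> y _; exact: (rudin_locally_finite (R := R)).
Qed.

(** * Developments and stationary strategies *)

Definition development (X : topologicalType) (G : nat -> set (set X)) :=
  [/\ forall n, open_cover (G n), forall n, refines (G n.+1) (G n)
    & forall (x : X) W, nbhs x W ->
      exists n, forall V, G n V -> V x -> V `<=` W].

Lemma fiber_dyadic (R : realType) (X : topologicalType)
    (Y : pseudoMetricType R) (f : Y -> X) (x : X) (W : set X) :
  continuous f -> compact (f @^-1` [set x]) -> nbhs x W ->
  exists n, forall y, f y = x -> ball y (dyadic n : R) `<=` f @^-1` W.
Proof.
move=> fcont /compact_near_coveringP fiber xW.
have [y yx|n _ /(_ n (leqnn n)) nW] :=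
    fiber _ \oo (fun n y => ball y (dyadic n : R) `<=` f @^-1` W) _;
    last by exists n.
have /nbhs_ballP [e /= e0 eW] : nbhs y (f @^-1` W).
  by apply: fcont; rewrite (yx : f y = x).
have [n ne] := @dyadic_lt R (e / 2) ltac:(by lra).
exists (ball y (dyadic n : R), [set k | (n <= k)%N]).
  by split; [exact/nbhsx_ballx/dyadic_gt0|exists n].
move=> [z k] [/= yz nk]; apply: subset_trans eW => w zw.
apply: le_ball (ball_triangle yz zw).
by have := @dyadic_le R _ _ nk; lra.
Qed.

Lemma open_compact_image_development (R : realType) (X : topologicalType)
    (Y : pseudoMetricType R) :
  open_compact_image X Y -> exists G : nat -> set (set X), development G.
Proof.
move=> [f [fcont fopen fsurj fcpt]].
exists (fun n => [set f @` (ball y (dyadic n : R))° | y in [set: Y]]); split.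
- move=> n; split=> [B [y _ <-]|]; first exact/fopen/open_interior.
  apply/seteqP; split=> // x _; have [y _ <-] := fsurj x I.
  exists (f @` (ball y (dyadic n : R))°); first by exists y.
  by exists y => //; exact/nbhsx_ballx/dyadic_gt0.
- move=> n _ [y _ <-]; exists (f @` (ball y (dyadic n : R))°); first by exists y.
  by apply/image_subset/interiorS/le_ball/dyadic_le.
(* One level beyond [n], since two points of a ball of radius [dyadic n.+1] are only within
   [dyadic n] of each other. *)
- move=> x W xW; have [n nW] := fiber_dyadic fcont (fcpt x) xW; exists n.+1.
  move=> _ [y _ <-] [w /interior_subset yw wx] _ [z /interior_subset yz <-].
  apply: (nW w wx); apply: le_ball (ball_triangle (ball_sym yw) yz).
  by have := @dyadicS R n; lra.
Qed.

Lemma partial_play_rcons (X : topologicalType) (S : response X) p x U :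
  partial_play S (rcons p (x, U)) -> open U /\ U x.
Proof.
move: {-2}(rcons _ _) (erefl (rcons p (x, U))) => q qE pq.
case: pq qE => [y V oV yV|r y V _ oV yV _]; last by move=> /rcons_inj[_ <- <-].
by rewrite -[[:: _]]/(rcons [::] _) => /rcons_inj[_ <- <-].
Qed.

Lemma development_response (X : topologicalType) (G : nat -> set (set X)) :
  (forall n, open_cover (G n)) -> forall (m : X * set X), exists V,
    open m.2 -> m.2 m.1 -> [/\ open V, V m.1, V `<=` m.2 &
    forall n, (forall k, (k < n)%N -> exists2 B, G k B & m.2 `<=` B) ->
      exists2 B, G n B & V `<=` B].
Proof.
move=> Gcov [x U] /=.
have [fineU|/existsNP ex] :=
    pselect (forall n, exists2 B, G n B & U `<=` B).
  by exists U => oU Ux; split.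
have ex' : exists n, `[< ~ exists2 B, G n B & U `<=` B >].
  by case: ex => n nU; exists n; apply/asboolP.
case: (ex_minnP ex') => n /asboolP nU nmin.
have [Gn covn] := Gcov n.
have [B GB Bx] : cover (G n) id x by rewrite covn.
exists (U `&` B) => oU Ux; split=> //; first exact: openI (Gn _ GB).
(* Here [n] is the first level at which [U] is not fine: [k > n] contradicts [kU], [k = n] is served
   by [B], and for [k < n] already [U] is fine. *)
move=> k kU; have [nk|] := ltnP n k; first by case: nU; exact: kU.
rewrite leq_eqVlt => /orP[/eqP ->|kn]; first by exists B.
have [|nfine] := pselect (exists2 B, G k B & U `<=` B).
  by case=> D GD UD; exists D => // z [/UD].
by have := nmin k; rewrite leqNgt kn => /(_ (asboolT nfine)).
Qed.

(* Answering (x, U) by a set that lies in a member of the first cover [G n]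
   not refined by U makes the n-th answer of any play lie in a member of [G n],
   although the strategy does not know the round number. *)
Lemma development_stationary (X : topologicalType) (G : nat -> set (set X)) :
  development G ->
  exists S : response X, [/\ strategy S, stationary S & convergent S].
Proof.
move=> [Gcov Gref Gstar]; have [g gP] := choice (development_response Gcov).
pose S : response X := fun p => if rev p is m :: _ then g m else setT.
have SE p m : S (rcons p m) = g m by rewrite /S rev_rcons.
exists S; split.
- move=> p x U /partial_play_rcons[oU Ux]; rewrite SE.
  by have [] := gP (x, U) oU Ux.
- by move=> p x U _; rewrite SE.
- move=> x U V [Umove UV Vmove] VS z zV.
  have {}VS i : V i = g (x i, U i) by rewrite VS mkseqS SE.
  have fineW n k A : (k <= n)%N -> (exists2 B, G n B & A `<=` B) ->
      exists2 B, G k B & A `<=` B.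
    move=> /subnK <-; elim: (n - k)%N A => [//|l IH] A [B GB AB].
    have [D GD BD] := Gref _ _ GB.
    by apply: IH; exists D => //; exact: subset_trans BD.
  have fineV n : exists2 B, G n B & V n `<=` B.
    elim: n => [|n [B GB VB]]; rewrite VS.
      have [oU Ux] := Umove 0%N.
      by have [_ _ _] := gP (x 0%N, U 0%N) oU Ux; apply.
    have [oU Ux] := Umove n.+1.
    have [_ _ _] := gP (x n.+1, U n.+1) oU Ux; apply=> k; rewrite ltnS => kn.
    by apply: (fineW _ _ _ kn); exists B => //; exact: subset_trans (UV n) VB.
  split=> [A [n _ <-]|W zW].
    by have [oV _ _] := Vmove n; apply: open_nbhs_nbhs; split=> //; exact: zV.
  have [n nW] := Gstar z W zW; have [B GB VB] := fineV n.
  exists (V n); first by exists n.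
  by apply: (subset_trans VB); apply: nW => //; exact/VB/zV.
Qed.

(** * Developments from convergent strategies *)

(** Otherwise [F] contains the complements of the finitely many fibers over [B], whose intersection
    misses the preimage of [B]. *)
Lemma ultra_finite (T : Type) (J : choiceType) (F : set_system T) (g : T -> J)
    (B : set J) : UltraFilter F -> finite_set B -> F (g @^-1` B) ->
  exists2 b, B b & F (g @^-1` [set b]).
Proof.
move=> FU /finite_fsetP[D ->] FB; apply: contrapT => none.
have FC : forall b : J, b \in D -> F (~` (g @^-1` [set b])).
  move=> b Db; have [Fb|//] := in_ultra_setVsetC (g @^-1` [set b]) FU.
  by case: none; exists b.
have [t [Bt /(_ _ Bt)]] := filter_ex (filterI FB (filter_bigI _ FC)).
exact.
Qed.

(* The branch is the limit, along a free ultrafilter, of the chains of ancestors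
   of chosen elements of the [N n]. *)
Lemma koenig (T : choiceType) (N : nat -> set T) (E : nat -> T -> T -> Prop) :
  (forall n, finite_set (N n)) -> (forall n, N n !=set0) ->
  (forall n t, N n.+1 t -> exists2 s, N n s & E n s t) ->
  exists b : nat -> T, forall n, N n (b n) /\ E n (b n) (b n.+1).
Proof.
move=> finN exN parent.
have ancestors n : exists a : nat -> T, (forall k, (k <= n)%N -> N k (a k)) /\
    forall k, (k < n)%N -> E k (a k) (a k.+1).
  have [t Nt] := exN n.
  suff [a [_ aP]] : exists a : nat -> T, a n = t /\
      (forall k, (k <= n)%N -> N k (a k)) /\
      forall k, (k < n)%N -> E k (a k) (a k.+1) by exists a.
  elim: n t Nt => [|n IH] t Nt.
    by exists (fun=> t); split=> //; split=> // k; rewrite leqn0 => /eqP ->.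
  have [s Ns Est] := parent n t Nt; have [a [an [Na Ea]]] := IH s Ns.
  exists (fun k => if (k <= n)%N then a k else t); rewrite ltnn; split=> //.
  split=> k.
    rewrite leq_eqVlt => /orP[/eqP ->|]; first by rewrite /= ltnn.
    by rewrite ltnS => kn; rewrite /= kn; exact: Na.
  rewrite ltnS leq_eqVlt => /orP[/eqP ->|kn]; first by rewrite eqxx ltnn an.
  by rewrite kn orbT; exact: Ea.
have [a aP] := choice ancestors.
have [F [FU ooF]] := ultraFilterLemma eventually_filter.
have Fge k : F [set n | (k <= n)%N] by apply: ooF; exists k.
have /choice[b bP] : forall k, exists t, N k t /\ F [set n | a n k = t].
  move=> k; have [|t Nt Ft] := ultra_finite (g := fun n => a n k) FU (finN k).
    by apply: filterS (Fge k) => n /= kn; have [aN _] := aP n; exact: aN.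
  by exists t.
exists b => k; split; first by have [] := bP k.
have [[_ Fk] [_ Fk1]] := (bP k, bP k.+1).
(* Some single chain [a n] realizes both limit values, so its edge is the required one. *)
have [n [[<- <-] kn]] := filter_ex (filterI (filterI Fk Fk1) (Fge k.+1)).
by have [_] := aP n; apply.
Qed.

Section Plays.
Context {X : topologicalType}.
Variable S : response X.

(* [Dh.2 H] is a play whose last answer contains the member [H] of the cover
   [Dh.1]. *)
Definition play_cover (Dh : set (set X) * (set X -> seq (X * set X))) :=
  [/\ open_cover Dh.1, point_finite Dh.1 &
    forall H, Dh.1 H -> partial_play S (Dh.2 H) /\ H `<=` S (Dh.2 H)].

(** The answers [S (p x)] cover the space; each member of a point-finite refinement inherits the
    play of an answer containing it. *)
Lemma play_cover_exists (p : X -> seq (X * set X)) : metacompact X ->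
  (forall x, [/\ partial_play S (p x), open (S (p x)) & S (p x) x]) ->
  exists2 Dh, play_cover Dh & forall H, Dh.1 H -> exists x, Dh.2 H = p x.
Proof.
move=> Xmeta pP.
have [|D [Dcov Dref Dfin]] := Xmeta [set S (p x) | x in [set: X]].
  split=> [_ [x _ <-]|]; first by have [] := pP x.
  by apply/seteqP; split=> // x _; exists (S (p x)); [exists x|have [] := pP x].
have /choice[h hP] : forall H, exists q, D H ->
    exists x, q = p x /\ H `<=` S (p x).
  move=> H; have [/Dref[_ [x _ <-] HS]|nD] := pselect (D H); last by exists [::].
  by exists (p x) => _; exists x.
exists (D, h); last by move=> H /= /hP[x [-> _]]; exists x.
by split=> //= H /hP[x [-> HS]]; split=> //; have [] := pP x.
Qed.

Lemma metacompact_development : metacompact X -> strategy S -> convergent S ->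
  exists2 G : nat -> set (set X), development G & forall n, point_finite (G n).
Proof.
move=> Xmeta Sstr Sconv.
have startP x : partial_play S (rcons [::] (x, setT)).
  by apply: partial_play1 => //; exact: openT.
have [Dh0 Dh0P start0] := play_cover_exists (p := fun x => [:: (x, setT)]) Xmeta
  (fun x => let: And3 a b _ := Sstr _ _ _ (startP x) in And3 (startP x) a b).
have step Dh : exists Dh', play_cover Dh -> play_cover Dh' /\
    forall H', Dh'.1 H' -> exists x H, Dh.1 H /\ Dh'.2 H' = rcons (Dh.2 H) (x, H).
  have [[[Dopen Dcov] Dfin Dplay]|nP] := pselect (play_cover Dh); last by exists Dh.
  have /choice[H HP] : forall x, exists H, Dh.1 H /\ H x.
    move=> x; have [H DH Hx] : cover Dh.1 id x by rewrite Dcov.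
    by exists H.
  (* The move [(x, H x)] is legal because [H x] lies in the last answer of its play. *)
  pose p x := rcons (Dh.2 (H x)) (x, H x).
  have pP x : partial_play S (p x).
    have [DH Hx] := HP x; have [pp sub] := Dplay _ DH.
    by apply: partial_playS => //; exact: Dopen.
  have [|Dh' Dh'P pE] := play_cover_exists (p := p) Xmeta.
    by move=> x; have [? ?] := Sstr _ _ _ (pP x).
  exists Dh' => _; split=> // H' /pE[x ->].
  by exists x, (H x); have [] := HP x.
have [next nextP] := choice step.
pose Dh n := iter n next Dh0.
have DhP n : play_cover (Dh n).
  by elim: n => [//|n IH]; have [] := nextP _ IH.
pose E n (H H' : set X) := exists x, (Dh n.+1).2 H' = rcons ((Dh n).2 H) (x, H).
have parent n H' : (Dh n.+1).1 H' -> exists2 H, (Dh n).1 H & E n H H'.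
  have [_ par] := nextP _ (DhP n).
  by move=> /par[x [H [DH HH']]]; exists H => //; exists x.
have sub n H H' : (Dh n.+1).1 H' -> E n H H' -> H' `<=` H.
  move=> DH' [x qE]; have [_ _ /(_ _ DH')[pp H'S]] := DhP n.+1.
  apply: (subset_trans H'S); move: pp; rewrite qE => pp.
  by have [] := Sstr _ _ _ pp.
exists (fun n => (Dh n).1); last by move=> n; have [] := DhP n.
split=> [n|n H' DH'|z W zW]; first by have [] := DhP n.
  by have [H DH HH'] := parent n H' DH'; exists H => //; exact: sub HH'.
apply: contrapT => /forallNP bad.
(* The nodes witness failure at level [n]; a parent contains its child, so it is a node too. *)
pose N n := [set H | (Dh n).1 H /\ (H z /\ ~ H `<=` W)].
have [n|n|n H' [DH' [H'z H'W]]|b bP] := koenig (N := N) (E := E).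
- have [_ /(_ z) fin _] := DhP n.
  by apply: sub_finite_set fin => H [DH [Hz _]].
- have /existsNP[H /not_implyP[DH /not_implyP[Hz HW]]] := bad n.
  by exists H.
- have [H DH HH'] := parent n H' DH'; exists H => //.
  have H'H := sub _ _ _ DH' HH'; split=> //; split; first exact: H'H.
  by apply: contra_not H'W; exact: subset_trans.
have [x0 x0E] := start0 (b 0%N) (proj1 (proj1 (bP 0%N))).
have [x xE] := choice (fun n => proj2 (bP n)).
(* Shifted by one: round 0 plays the whole space, round [n.+1] plays [b n], and [V n] contains
   [b n]. *)
pose xx n := if n is k.+1 then x k else x0.
pose U n := if n is k.+1 then b k else setT.
pose V n := S ((Dh n).2 (b n)).
have qE n : (Dh n).2 (b n) = mkseq (fun j => (xx j, U j)) n.+1.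
  by elim: n => [//|n IH]; rewrite xE IH [in RHS]mkseqS.
have play n : partial_play S (rcons (mkseq (fun j => (xx j, U j)) n) (xx n, U n)).
  have [[Db _] _] := bP n; have [_ _ /(_ _ Db)[+ _]] := DhP n.
  by rewrite qE mkseqS.
have bV n : b n `<=` V n.
  by have [[Db _] _] := bP n; have [_ _ /(_ _ Db)[]] := DhP n.
have [_ /(_ W zW)[_ [n _ <-] VW]] : nbhs_basis z (range V).
  apply: (Sconv xx U V) => [|n|n _]; last first.
  - by have [[_ [bz _]] _] := bP n; exact: bV.
  - by rewrite /V qE.
  split=> n; first exact: partial_play_rcons (play n).
    exact: bV.
  by have := Sstr _ _ _ (play n); rewrite -mkseqS -qE.
have [[_ [_ bW]] _] := bP n; apply: bW; exact: subset_trans (@bV n) VW.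
Qed.
End Plays.

(** * The space of sequences of members of a development *)

(* The first-difference ultrametric; R occurs in the type only so that
   [baire_space R P] determines the field in which distances live. *)
Definition baire_space (R : realType) (T : Type) (P : set (nat -> T)) :=
  {s : nat -> T | P s}.

Section BaireMetric.
Context {R : realType} {T : Type} {P : set (nat -> T)}.
Notation Y := (baire_space R P).
Implicit Types s t u : Y.

HB.instance Definition _ := gen_eqMixin Y.
HB.instance Definition _ := gen_choiceMixin Y.

Definition agree n s t := forall k, (k <= n)%N -> sval s k = sval t k.

Lemma first_difference s t :
  {n | ~ agree n s t /\ forall k, ~ agree k s t -> (n <= k)%N} +
  {forall n, agree n s t}.
Proof.
have [|/existsNP/cid ex] := pselect (forall n, agree n s t); first by right.
have ex' : exists n, `[< ~ agree n s t >].
  by case: ex => n ?; exists n; apply/asboolP.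
left; case: (ex_minnP ex') => n /asboolP ? nmin.
by exists n; split=> // k ?; apply: nmin; apply/asboolP.
Qed.

Definition baire_dist s t : R :=
  if first_difference s t is inleft n then dyadic (sval n) else 0.

Lemma baire_dist_ge0 s t : 0 <= baire_dist s t.
Proof.
rewrite /baire_dist; case: first_difference => // n.
exact/ltW/dyadic_gt0.
Qed.

Lemma baire_dist_lt s t n : (baire_dist s t < dyadic n) <-> agree n s t.
Proof.
rewrite /baire_dist; case: first_difference => [[m [/= mst mmin]]|st]; last first.
  by rewrite dyadic_gt0.
split=> [mn|nst].
  apply: contrapT => /mmin /(@dyadic_le R).
  by rewrite leNgt mn.
rewrite ltNge; apply/negP => nm; apply: mst => k km; apply: nst.
rewrite leqNgt; apply/negP => nk.
have := @dyadic_le R _ _ (leq_trans nk km); have := @dyadicS R n.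
by have := @dyadic_gt0 R n; lra.
Qed.

(** A distance is 0 or some [dyadic n], so inequalities reduce by contraposition to [agree] via
    [baire_dist_lt]. *)
Lemma baire_distP s t e :
  (forall n, dyadic n <= baire_dist s t -> dyadic n <= e) -> 0 <= e ->
  baire_dist s t <= e.
Proof.
rewrite {2}/baire_dist => eP e0; move: eP; rewrite /baire_dist.
by case: first_difference => [[m ?] /= |] //; apply.
Qed.

Lemma baire_distxx s : baire_dist s s = 0.
Proof.
apply/eqP; rewrite eq_le baire_dist_ge0 andbT; apply: baire_distP => // n.
by rewrite leNgt (_ : _ < _) //; apply/baire_dist_lt.
Qed.

Lemma baire_dist_positivity s t : baire_dist s t = 0 -> s = t.
Proof.
move=> st0; have st n : sval s n = sval t n.
  have /baire_dist_lt/(_ n (leqnn n)) // : baire_dist s t < dyadic n.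
  by rewrite st0 dyadic_gt0.
case: s t {st0} st => [s Ps] [t Pt] /= /funext st.
by move: Pt; rewrite -st => Pt; rewrite (Prop_irrelevance Ps Pt).
Qed.

Lemma baire_dist_sym s t : baire_dist s t = baire_dist t s.
Proof.
wlog suff : s t / baire_dist s t <= baire_dist t s.
  by move=> le; apply/eqP; rewrite eq_le !le.
apply: baire_distP (baire_dist_ge0 _ _) => n; apply: contraTT.
rewrite -!ltNge => /baire_dist_lt ts; apply/baire_dist_lt => k kn.
by rewrite ts.
Qed.

Lemma baire_dist_triangle t s u :
  baire_dist s u <= baire_dist s t + baire_dist t u.
Proof.
have st0 := baire_dist_ge0 s t; have tu0 := baire_dist_ge0 t u.
apply: baire_distP (addr_ge0 st0 tu0) => n; apply: contraTT.
rewrite -!ltNge => lt_n; apply/baire_dist_lt => k kn.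
have /baire_dist_lt -> // : baire_dist s t < dyadic n by lra.
by have /baire_dist_lt -> // : baire_dist t u < dyadic n by lra.
Qed.

HB.instance Definition _ := isMetric.Build R Y baire_distxx
  baire_dist_positivity baire_dist_sym baire_dist_triangle.

Lemma baire_nbhsP s (A : set Y) :
  nbhs s A <-> exists n, [set t | agree n s t] `<=` A.
Proof.
split=> [/nbhs_ballP[e /= e0 eA]|[n nA]].
  have [n ne] := dyadic_lt e0; exists n => t /= /baire_dist_lt st; apply: eA.
  by rewrite ballEmdist; exact: lt_trans st ne.
apply/nbhs_ballP; exists (dyadic n) => /=; first exact: dyadic_gt0.
move=> t; rewrite ballEmdist => st; apply: nA; exact/baire_dist_lt.
Qed.

End BaireMetric.

Lemma near_forall_leq (T : Type) (F : set_system T) (P : nat -> set T) n :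
  Filter F -> (forall k, (k <= n)%N -> F (P k)) ->
  F [set x | forall k, (k <= n)%N -> P k x].
Proof.
move=> FF FP; have := @filter_forall _ 'I_n.+1 (fun i => P i) F FF.
move=> /(_ (fun i => FP i (ltn_ord i : (i <= n)%N))).
by apply: filterS => x xP k kn; exact: (xP (Ordinal (kn : (k < n.+1)%N))).
Qed.

Lemma point_finite_development_image (R : realType) (X : topologicalType)
    (G : nat -> set (set X)) : accessible_space X -> development G ->
  (forall n, point_finite (G n)) ->
  exists Y : metricType R, open_compact_image X Y.
Proof.
move=> T1 [Gcov _ Gstar] Gfin.
pose P := [set H : nat -> set X |
  (forall n, G n (H n)) /\ exists x, forall n, H n x].
pose Y : metricType R := baire_space R P.
have uniq_point H x y : (forall n, G n (H n)) -> (forall n, H n x) ->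
    (forall n, H n y) -> x = y.
  move=> GH Hx Hy; apply: contrapT => /eqP/T1[U [oU /set_mem Ux /set_mem Uy]].
  have [|n nU] := Gstar x U; first by apply: open_nbhs_nbhs.
  by apply: Uy; apply: nU (Hy n).
have pointP (y : Y) : exists x, forall n, sval y n x by case: y => H [].
pose f (y : Y) := sval (cid (pointP y)).
have fP (y : Y) n : sval y n (f y) by rewrite /f; case: cid.
have fE (y : Y) x : (forall n, sval y n x) -> f y = x.
  move=> yx; apply: (uniq_point (sval y)) => //; first by case: (y) => H [].
have member x : exists H : nat -> set X, forall n, G n (H n) /\ H n x.
  suff /choice[H HP] : forall n, exists V, G n V /\ V x by exists H.
  move=> n; have [_ cov] := Gcov n.
  by have [V GV Vx] : cover (G n) id x by [rewrite cov]; exists V.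
have mkpoint H x : (forall n, G n (H n)) -> (forall n, H n x) ->
    exists2 y : Y, sval y = H & f y = x.
  move=> GH Hx; have PH : P H by split=> //; exists x.
  by exists (exist _ H PH) => //; exact: fE.
exists Y, f; split.
- move=> y W /= /Gstar[n nW]; apply/baire_nbhsP; exists n => t yt /=.
  apply: (nW (sval y n)); [by case: (y) => H []|exact: fP|].
  by rewrite (yt n (leqnn n)); exact: fP.
- move=> U oU; rewrite openE => _ [y Uy <-].
  have /baire_nbhsP[n nU] : nbhs y U by exact: open_nbhs_nbhs.
  have : nbhs (f y) [set x | forall k, (k <= n)%N -> sval y k x].
    apply: near_forall_leq => k _; apply: open_nbhs_nbhs; split; last exact: fP.
    have [Gopen _] := Gcov k; apply: Gopen; by case: (y) => H [].
  apply: filterS => x xy; have [H HP] := member x.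
  (* A point over [x] near [y]: keep the members of [y] up to index [n] and continue with any
     members containing [x]. *)
  have [k|k|t tE tx] :=
    mkpoint (fun k => if (k <= n)%N then sval y k else H k) x.
  + by case: ifP => _; [case: (y) => ? []|have [] := HP k].
  + by case: ifP => [/xy|_] //; have [] := HP k.
  + by exists t => //; apply: nU => k kn; rewrite tE kn.
- move=> x _; have [H HP] := member x.
  have [k|k|t _ tx] := mkpoint H x; [by have [] := HP k| by have [] := HP k|].
  by exists t.
- move=> x; rewrite compact_ultra => F FU Fx.
  (* On the fiber each coordinate takes finitely many values, so the ultrafilter fixes one; these
     values form the limit. *)
  have coord n : exists V, (G n V /\ V x) /\ F [set y : Y | sval y n = V].
    have [|V] := ultra_finite (g := fun y : Y => sval y n) FU (Gfin n x).
      apply: filterS Fx => y yx /=; split; first by case: (y) => H [].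
      by rewrite -(yx : f y = x); exact: fP.
    by exists V.
  have [H HP] := choice coord.
  have [k|k|t tE tx] := mkpoint H x; [by have [[]] := HP k| by have [[]] := HP k|].
  exists t; split=> // A /baire_nbhsP[n nA].
  apply: filterS nA _; apply: near_forall_leq => k _.
  by rewrite tE; have [_] := HP k; apply: filterS => y ->.
Qed.

Theorem theorem8 (R : realType) (X : topologicalType)
    (hT1 : accessible_space X) :
  ((exists Y : metricType R, open_compact_image X Y) <->
   (metacompact X /\ exists S : response X, strategy S /\ convergent S)) /\
  ((exists Y : metricType R, open_compact_image X Y) ->
   exists S : response X, [/\ strategy S, stationary S & convergent S]).
Proof.
split; last first.
  by move=> [Y /open_compact_image_development[G]]; exact: development_stationary.
split=> [[Y im]|[Xmeta [S [Sstr Sconv]]]].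
  split; first exact: open_compact_image_metacompact im.
  have [G /development_stationary[S [Sstr _ Sconv]]] :=
    open_compact_image_development im.
  by exists S.
have [G Gdev Gfin] := metacompact_development Xmeta Sstr Sconv.
exact: point_finite_development_image hT1 Gdev Gfin.
Qed.
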